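(* Let $\beta\in(0,\pi/2)$ be defined by $\cot\beta=\frac{\ln(2\pi+1)}{2\pi}$ (so $\beta\approx 1.264714$ and $\frac{1}{\cos\beta}\approx 3.3186738$), and fix $a>0$. For a starting point $s$, consider the spiral strategy: the path that, in polar coordinates centred at $s$ (with an arbitrary reference direction), follows the logarithmic spiral $\varphi\mapsto(\varphi,\,a\,e^{\varphi\cot\beta})$ for increasing $\varphi\in(-\infty,\infty)$, starting at $s$ (its arc length from $s$ up to the point with angle $\varphi$ is $\frac{a}{\cos\beta}e^{\varphi\cot\beta}$). Then for every environment $P$ and every starting point $s$ in the kernel of $P$, and for every rotation of $P$ about $s$, this spiral path reaches the boundary $\partial P$ after a path length smaller than $3.318674\cdot \Pi_s$, where $\Pi_s$ is the length of the certificate path of $P$ at $s$.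
   Context: An environment is the closed bounded region $P\subset\mathbb{R}^2$ enclosed by a closed Jordan curve $\partial P$. The kernel of $P$ is the set of points $s\in P$ such that for every $q\in P$ the segment $sq$ lies in $P$ (so from $s$ each ray meets $\partial P$ in exactly one point). For $s$ in the interior of $P$ and $x>0$, let $C_s(x)$ be the circle of radius $x$ centred at $s$. For $x$ such that $C_s(x)\cap\partial P\neq\emptyset$, let $\alpha_s(x)\in[0,2\pi]$ be the supremum of the angles of arcs of $C_s(x)$ contained in the interior of $P$ (and $0$ if there is none). A circular strategy for distance $x$ moves from $s$ straight a distance $x$ in some direction and then along $C_s(x)$ (in a fixed orientation) for an angle $\alpha_s(x)$; it meets $\partial P$ regardless of the starting direction, and has length $x(1+\alpha_s(x))$. The certificate path of $P$ at $s$ has length $\Pi_s=\min_x x(1+\alpha_s(x))$, the minimum over all $x>0$ with $C_s(x)\cap\partial P\neq\emptyset$. The path length of a strategy is measured from $s$ to the first point at which it meets $\partial P$. *)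

(* Defs.v *)
From HB Require Import structures.
From mathcomp Require Import all_boot all_order all_algebra.
From mathcomp Require Import all_classical all_reals all_analysis.
Set Implicit Arguments. Unset Strict Implicit. Unset Printing Implicit Defensive.
Import Order.TTheory GRing.Theory Num.Theory.
Import numFieldNormedType.Exports.
Local Open Scope classical_set_scope.
Local Open Scope ring_scope.

Section Defs.
Variable R : realType.
Notation pt := (R * R)%type.

Definition edist (p q : pt) : R :=
  Num.sqrt ((p.1 - q.1) ^+ 2 + (p.2 - q.2) ^+ 2).

Definition polar (s : pt) (r t : R) : pt := (s.1 + r * cos t, s.2 + r * sin t).

Definition jordan_curve (g : R -> pt) : Prop :=
  (forall t e, 0 < e -> exists2 d, 0 < d &
      forall u, `|u - t| < d -> edist (g u) (g t) < e) /\
  (forall t, g (t + 1) = g t) /\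
  (forall t u, 0 <= t < 1 -> 0 <= u < 1 -> g t = g u -> t = u).

Definition bounded_plane (A : set pt) : Prop :=
  exists M : R, forall y, A y -> `|y.1| <= M /\ `|y.2| <= M.

Definition enclosed (g : R -> pt) : set pt :=
  [set x | range g x \/
     (~ range g x /\ bounded_plane (@connected_component (R * R)%type (~` range g) x))].

Definition environment (P : set pt) (g : R -> pt) : Prop :=
  jordan_curve g /\ P = enclosed g.

Definition int_pt (P : set pt) (x : pt) : Prop :=
  exists2 e : R, 0 < e & forall y, edist x y < e -> P y.

Definition segment (s q : pt) : set pt :=
  [set p | exists2 l : R, 0 <= l <= 1 &
     p = (s.1 + l * (q.1 - s.1), s.2 + l * (q.2 - s.2))].

Definition star_kernel (P : set pt) : set pt :=
  [set s | P s /\ forall q, P q -> segment s q `<=` P].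

(* angles of (closed) arcs of C_s(x) contained in the interior of P,
   together with 0 (the convention when there is no such arc) *)
Definition arc_angles (P : set pt) (s : pt) (x : R) : set R :=
  [set th | 0 <= th <= 2 * pi /\
     (th = 0 \/ exists th0 : R, forall t, 0 <= t <= th ->
        int_pt P (polar s x (th0 + t)))].

Definition alpha (P : set pt) (s : pt) (x : R) : R := sup (arc_angles P s x).

Definition meets_boundary (g : R -> pt) (s : pt) (x : R) : Prop :=
  0 < x /\ exists t, range g (polar s x t).

Definition certificate_length (P : set pt) (g : R -> pt) (s : pt) : R :=
  inf [set x * (1 + alpha P s x) | x in meets_boundary g s].

Definition spiral (s : pt) (a beta psi phi : R) : pt :=
  polar s (a * expR (phi * (cos beta / sin beta))) (phi + psi).

Definition spiral_length (a beta phi : R) : R :=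
  a / cos beta * expR (phi * (cos beta / sin beta)).

End Defs.

(* Main.v *)
(** Let [x] be a radius for which the circle about [s] meets the boundary.  If
    the spiral has not met the boundary while turning by an angle [th] from
    radius [x] on, then, [P] being star-shaped about [s], the arc of angle [th]
    below it on the circle of radius [x] lies in the interior of [P].  Hence
    [th <= alpha x], and the spiral is stopped after length at most
    [x * exp (alpha x * cot beta) / cos beta], which convexity of [exp] on
    [0, 2 pi] bounds by [x * (1 + alpha x) / cos beta]: the choice of [beta]
    makes the chord through the endpoints equal to [1 + alpha].

    When [alpha x = 2 pi] the whole circle would be interior to [P], so one needs
    that no point of the curve is interior to [P].  This part of the Jordan curve
    theorem has a short proof for star-shaped [P].  Otherwise the topological
    boundary of [P] is contained in a simple arc, and each ray from [s] meets it
    in a segment, i.e. in an interval of arc parameters.  Opposite rays give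
    disjoint intervals; whichever comes first cannot change while the rays
    rotate, but after half a turn they have been exchanged. *)
Require Import Defs.
From HB Require Import structures.
From mathcomp Require Import all_boot all_order all_algebra.
From mathcomp Require Import all_classical all_reals all_analysis.
From mathcomp Require Import ring lra.
Import Order.TTheory GRing.Theory Num.Theory.
Import numFieldNormedType.Exports.
Local Open Scope classical_set_scope.
Local Open Scope ring_scope.
Set Implicit Arguments. Unset Strict Implicit.

(** * Numerical bounds *)

Lemma is_derive_ge0_le (R : realType) (f df : R -> R) (x : R) : 0 <= x ->
  (forall y, is_derive y (1 : R) f (df y)) -> (forall y, 0 <= y -> 0 <= df y) ->
  f 0 <= f x.
Proof.
move=> x0 fdf df0; have [->//|xn0] := eqVneq x 0.
have xgt0 : 0 < x by rewrite lt_neqAle eq_sym xn0.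
have [|c] := MVT xgt0 (fun y _ => fdf y).
  by apply: derivable_within_continuous => z _; case: (fdf z).
rewrite in_itv/= => /andP[/ltW/df0 dc _] E.
by rewrite -subr_ge0 E subr0 mulr_ge0.
Qed.

Lemma is_derive_expr (R : realType) n (x : R) :
  is_derive x (1 : R) (fun y : R => y ^+ n) (n%:R * x ^+ n.-1).
Proof.
have -> : (fun y : R => y ^+ n) = (@id R) ^+ n by apply/funext => y; rewrite fctE.
have /= H := is_deriveX n (is_derive_id x (1 : R)).
by apply: is_derive_eq; rewrite -[_ *: _]/(_ * _) mulr1.
Qed.

Lemma is_derive_scale (R : realType) (f : R -> R) (k x df : R) :
  is_derive x (1 : R) f df -> is_derive x (1 : R) (fun y => k * f y) (k * df).
Proof. exact: is_deriveZ. Qed.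

Definition atan_taylor (R : realType) n (x : R) : R :=
  \sum_(i < n) (- 1) ^+ i / i.*2.+1%:R * x ^+ i.*2.+1.

(** The signed error vanishes at 0, and summing a geometric progression gives its derivative
    [y ^ (2n) / (1 + y ^ 2)]. Even [n] yield lower bounds of [atan], odd [n] upper bounds. *)
Lemma atan_taylor_bound (R : realType) n (x : R) : 0 <= x ->
  0 <= (- 1) ^+ n * (atan x - atan_taylor n x).
Proof.
move=> x0.
pose df (y : R) := (y ^+ 2) ^+ n / (1 + y ^+ 2).
have fdf y : is_derive y (1 : R) (fun z : R => (- 1) ^+ n * (atan z - atan_taylor n z)) (df y).
  have H : is_derive y (1 : R) (@atan_taylor R n) (\sum_(i < n) (- y ^+ 2) ^+ i).
    pose h (i : 'I_n) (z : R) := (- 1) ^+ i / i.*2.+1%:R * z ^+ i.*2.+1 : R.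
    have -> : @atan_taylor R n = \sum_(i < n) h i by apply/funext => z; rewrite fct_sumE.
    apply: is_derive_sum => i.
    apply: (is_derive_eq (is_derive_scale _ (is_derive_expr i.*2.+1 y))).
    rewrite /= mulrA mulfVK ?pnatr_eq0//.
    by rewrite -[in RHS]mulN1r exprMn -exprM mul2n.
  apply: (is_derive_eq (is_derive_scale ((- 1) ^+ n) (is_deriveB (is_derive1_atan y) H))).
  have y1 : 1 + y ^+ 2 != 0 by rewrite gt_eqF// ltr_pwDl// sqr_ge0.
  have -> : \sum_(i < n) (- y ^+ 2) ^+ i = (1 - (- y ^+ 2) ^+ n) / (1 + y ^+ 2).
    apply: (canRL (mulfK y1)); rewrite -[1 - _]opprB subrX1; ring.
  have -> : (- y ^+ 2) ^+ n = (-1) ^+ n * (y ^+ 2) ^+ n by rewrite -exprMn mulN1r.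
  have : (- 1) ^+ n * (- 1) ^+ n = 1 :> R by rewrite -exprMn mulrNN mulr1 expr1n.
  rewrite /df; move: ((- 1) ^+ n) => e e1.
  by transitivity (e * e * ((y ^+ 2) ^+ n / (1 + y ^+ 2))); [field | rewrite e1 mul1r].
have -> : 0 = (-1) ^+ n * (atan 0 - atan_taylor n 0) :> R.
  rewrite atan0 /atan_taylor big1 ?subrr ?mulr0// => i _.
  by rewrite expr0n mulr0.
apply: (is_derive_ge0_le x0 fdf) => y y0.
by rewrite divr_ge0 ?exprn_ge0 ?addr_ge0 ?sqr_ge0.
Qed.

(** The Taylor remainder is at most [expR x * x ^ (n+1) / (n+1)!]. Moved to the left-hand side, it
    gives an explicit upper bound of [expR x] whenever the factor there is positive. *)
Lemma expR_taylor_bound (R : realType) n (x : R) : 0 <= x ->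
  expR x * (1 - x ^+ n.+1 / n.+1`!%:R) <= \sum_(i < n.+1) x ^+ i / i`!%:R.
Proof.
move=> x0.
pose F m (y : R) := \sum_(i < m) i`!%:R^-1 * y ^+ i.
have dF m (y : R) : is_derive y (1 : R) (F m.+1) (F m y).
  pose h (i : 'I_m.+1) (z : R) := i`!%:R^-1 * z ^+ i : R.
  have -> : F m.+1 = \sum_(i < m.+1) h i by apply/funext => z; rewrite fct_sumE.
  have dh i : is_derive y (1 : R) (h i) (i`!%:R^-1 * (i%:R * y ^+ i.-1)).
    exact: is_derive_scale (is_derive_expr i y).
  apply: (is_derive_eq (is_derive_sum dh)).
  rewrite big_ord_recl !mul0r mulr0 add0r; apply: eq_bigr => i _ /=.
  by rewrite /bump/= add1n factS natrM invfM mulrACA mulVf ?mul1r ?pnatr_eq0.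
(* [h] is nondecreasing and [h 0 = 1]; multiply [1 <= h x] by [expR x]. *)
pose h (y : R) := expR (- y) * F n.+1 y + n.+1`!%:R^-1 * y ^+ n.+1.
pose dh (y : R) := (1 - expR (- y)) * (n`!%:R^-1 * y ^+ n).
have hdh y : is_derive y (1 : R) h (dh y).
  have dE : is_derive y (1 : R) (fun z => expR (- z)) (- expR (- y)).
    have := is_derive1_comp (is_derive_expR (- y)) (is_deriveN (is_derive_id y (1:R))).
    by move/is_derive_eq; apply; rewrite mulrN1.
  apply: (is_derive_eq (is_deriveD (is_deriveM dE (dF n y))
    (is_derive_scale n.+1`!%:R^-1 (is_derive_expr n.+1 y)))).
  rewrite /dh -![_ *: _]/(_ * _) /F big_ord_recr/=.
  rewrite factS natrM.
  field.
  by rewrite !(pnatr_eq0, addn_eq0) /= -lt0n fact_gt0 nat1r pnatr_eq0.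
have : h 0 <= h x.
  apply: (is_derive_ge0_le x0 hdh) => y y0.
  rewrite mulr_ge0 ?mulr_ge0 ?invr_ge0 ?exprn_ge0 ?ler0n// subr_ge0.
  by rewrite expR_le1 oppr_le0.
have -> : h 0 = 1.
  rewrite /h /F big_ord_recl big1 => [|i _]; last by rewrite expr0n/= mulr0.
  by rewrite expr0 fact0 invr1 oppr0 expR0 expr0n/= mulr0 !addr0 !mul1r.
have -> : \sum_(i < n.+1) x ^+ i / i`!%:R = F n.+1 x.
  by apply: eq_bigr => i _; rewrite mulrC.
rewrite -(ler_pM2l (expR_gt0 x)) mulr1 /h mulrDr mulrA -expRD subrr expR0 mul1r.
by rewrite mulrBr mulr1 lerBlDr [_ / _]mulrC.
Qed.

(** The angle [A] in brackets has tangent 1, and the crude bounds [0 <= atan x <= x] place it in the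
    range where [atan] inverts [tan]. *)
Lemma machin_formula (R : realType) : pi = 4 * (4 * atan 5^-1 - atan 239^-1) :> R.
Proof.
pose a : R := atan 5^-1; pose b : R := atan 239^-1.
have bnd (x : R) : 0 <= x -> 0 <= atan x <= x.
  move=> x0; apply/andP; split; first by rewrite -(@atan0 R) le_atan.
  have := atan_taylor_bound 1 x0.
  rewrite /atan_taylor big_ord1 /= double0 expr0 !expr1 divr1; lra.
have sc (x : R) : sin (atan x) = x * cos (atan x).
  have H : cos (atan x) != 0 by rewrite gt_eqF// cos_gt0_pihalf// atan_gtNpi2 atan_ltpi2.
  by rewrite -[X in _ = X * _](atanK x) /tan divfK.
have a5 : 0 <= a <= 5^-1 by rewrite bnd// invr_ge0.
have b239 : 0 <= b <= 239^-1 by apply: bnd; lra.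
have p2 := @pihalf_ge1 R.
pose A : R := a + a + (a + a) - b.
have cA : 0 < cos A by rewrite cos_gt0_pihalf// /A; lra.
have sA : sin A = cos A.
  (* With each sine replaced by [x * cos], both sides are the same rational multiple of a product of
     cosines. *)
  by rewrite /A !(sinB, cosB, sinD, cosD) !sc; field.
have tA : tan A = 1 by rewrite /tan sA divff// gt_eqF.
have : atan (tan A) = pi / 4 by rewrite tA atan1.
rewrite tanK; last by rewrite in_itv/=; rewrite /A; lra.
rewrite -/a -/b /A; lra.
Qed.

Lemma pi_bounds (R : realType) :
  3 + 141 / 10 ^+ 3 + 592 / 10 ^+ 6 + 65 / 10 ^+ 8 < (pi : R) <
  3 + 141 / 10 ^+ 3 + 592 / 10 ^+ 6 + 66 / 10 ^+ 8.
Proof.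
have x0 : 0 <= 5^-1 :> R by lra.
have y0 : 0 <= 239^-1 :> R by lra.
(* Consecutive orders enclose each arctangent from both sides, tightly enough for eight decimals of
   [pi]. *)
move: (atan_taylor_bound 6 x0) (atan_taylor_bound 7 x0).
move: (atan_taylor_bound 2 y0) (atan_taylor_bound 3 y0).
rewrite machin_formula /atan_taylor !big_ord_recr !big_ord0.
move=> H1 H2 H3 H4; rewrite /= !doubleS double0 in H1 H2 H3 H4.
by apply/andP; split; lra.
Qed.

(** After exponentiation the claim is [expR (K * (2 * pi)) < 2 * pi + 1] with [K = 0.316013005]. The
    fourth root of the left side has an argument below 1/2, where a Taylor polynomial of degree 8 is
    accurate enough. *)
Lemma cot_beta_gt (R : realType) :
  (316 / 10 ^+ 3 + 13 / 10 ^+ 6 + 5 / 10 ^+ 9) < ln (2 * pi + 1) / (2 * pi) :> R.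
Proof.
have /andP[lo hi] := pi_bounds R; have p0 := @pi_gt0 R.
have p2 : 0 < 2 * pi :> R by lra.
rewrite ltr_pdivlMr// -ltr_expR lnK ?posrE; last by lra.
pose z : R := 2 * (3 + 141 / 10 ^+ 3 + 592 / 10 ^+ 6 + 66 / 10 ^+ 8) *
  (316 / 10 ^+ 3 + 13 / 10 ^+ 6 + 5 / 10 ^+ 9) / 4.
have z0 : 0 <= z by rewrite /z; lra.
have le : expR ((316 / 10 ^+ 3 + 13 / 10 ^+ 6 + 5 / 10 ^+ 9) * (2 * pi)) <= expR z ^+ 4 :> R.
  by rewrite -expRM_natl ler_expR /z; lra.
apply: (le_lt_trans le).
have e1 : expR z < (1 + 642 / 10 ^+ 3 + 783 / 10 ^+ 6 + 52 / 10 ^+ 8).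
  have := expR_taylor_bound 8 z0.
  have -> : 9`!%:R = 720 * 504 :> R by rewrite !factS fact0 !natrM; field.
  have c0 : 0 < 1 - z ^+ 9 / (720 * 504) by rewrite invfM /z; lra.
  rewrite -ler_pdivlMr// => /le_lt_trans; apply; rewrite ltr_pdivrMr//.
  rewrite !big_ord_recr !big_ord0.
  rewrite [X in X < _](_ : _ = 0 + 1 + z + z ^+ 2 / 2 + z ^+ 3 / 6 + z ^+ 4 / 24
    + z ^+ 5 / 120 + z ^+ 6 / 720 + z ^+ 7 / 720 / 7 + z ^+ 8 / 720 / 56); last first.
    by move: z {z0 le c0} => z; rewrite !factS fact0 /= !natrM; field.
  rewrite invfM /z; lra.
have e0 := expR_gt0 z.
apply: (@lt_trans _ _ ((1 + 642 / 10 ^+ 3 + 783 / 10 ^+ 6 + 52 / 10 ^+ 8) ^+ 4)); last by lra.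
by rewrite ltrXn2r// ?ltW//; lra.
Qed.

(** From [c > K * s] and [c ^ 2 + s ^ 2 = 1] follows [c ^ 2 > K ^ 2 / (1 + K ^ 2)], and this exceeds
    [1 / C ^ 2] for [C = 3.318674]. *)
Lemma cos_beta_gt (R : realType) (beta : R) : 0 < beta < pi / 2 ->
  cos beta / sin beta = ln (2 * pi + 1) / (2 * pi) ->
  1 < (3318674%:Z)%:~R / (1000000%:Z)%:~R * cos beta.
Proof.
move=> /andP[b0 b1] hcot.
rewrite (_ : _ / _ = 3 + 318 / 10 ^+ 3 + 674 / 10 ^+ 6); last by field.
have s0 : 0 < sin beta by apply: sin_gt0_pihalf; rewrite b0 b1.
have c0 : 0 < cos beta by apply: cos_gt0_pihalf; rewrite b1 andbT; have := @pi_gt0 R; lra.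
have := cot_beta_gt R; rewrite -hcot ltr_pdivlMr//.
have := cos2Dsin2 beta.
move: (cos beta) (sin beta) c0 s0 => c s c0 s0 cs k.
set K := (X in X * s < c) in k; set C := (X in 1 < X * c).
have KC : 1 + K ^+ 2 < C ^+ 2 * K ^+ 2 by rewrite /K /C; lra.
have K0 : 0 < K by rewrite /K; lra.
have C0 : 0 < C by rewrite /C; lra.
have C1 : 0 < C ^+ 2 - 1 by rewrite /C; lra.
have kc : (K * s) ^+ 2 < c ^+ 2.
  by rewrite ltr_pXn2r// nnegrE; [exact/ltW/mulr_gt0|exact/ltW].
rewrite -(@ltr_pXn2r _ 2)// ?nnegrE ?ler01//; last exact/ltW/mulr_gt0.
rewrite expr1n exprMn.
(* The sum of this product and the next one is [C ^ 2 * c ^ 2 - 1], since [c ^ 2 + s ^ 2 = 1]. *)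
have : 0 < (C ^+ 2 - 1) * (c ^+ 2 - (K * s) ^+ 2) by rewrite mulr_gt0// subr_gt0.
have : 0 < (C ^+ 2 * K ^+ 2 - (1 + K ^+ 2)) * s ^+ 2 by rewrite mulr_gt0// ?subr_gt0// exprn_gt0.
nra.
Qed.

(** * Polar coordinates *)

Section Plane.
Variable R : realType.
Local Notation pt := (R * R)%type.
Local Notation edist := (@Defs.edist R).
Implicit Types (P : set pt) (s x y : pt) (r t : R).

Lemma norm_fst_le_edist x y : `|x.1 - y.1| <= edist x y.
Proof. by rewrite -sqrtr_sqr ler_wsqrtr// lerDl sqr_ge0. Qed.

Lemma norm_snd_le_edist x y : `|x.2 - y.2| <= edist x y.
Proof. by rewrite -sqrtr_sqr ler_wsqrtr// lerDr sqr_ge0. Qed.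

Lemma edist_le x y : edist x y <= `|x.1 - y.1| + `|x.2 - y.2|.
Proof.
have [u0 v0] := (normr_ge0 (x.1 - y.1), normr_ge0 (x.2 - y.2)).
rewrite -[leRHS]ger0_norm ?addr_ge0// -sqrtr_sqr ler_wsqrtr//.
rewrite -(real_normK (num_real (x.1 - y.1))) -(real_normK (num_real (x.2 - y.2))).
move: u0 v0; move: `|_| `|_| => u v u0 v0.
by have := mulr_ge0 u0 v0; nra.
Qed.

Lemma edist_polar s r t : 0 <= r -> edist s (polar s r t) = r.
Proof.
move=> r0; rewrite /edist /polar/= -[in RHS](ger0_norm r0) -sqrtr_sqr.
congr Num.sqrt; have := cos2Dsin2 t; set c := cos t; set d := sin t => E.
by rewrite -[RHS]mulr1 -E; ring.
Qed.

(** The Euclidean distance lies between the maximum and the sum of the coordinate distances, so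
    Euclidean discs and the balls of the product topology are nested in each other. *)
Lemma int_ptE P x : int_pt P x = P° x.
Proof.
apply/propext; rewrite /interior; split.
  move=> [e e0 eP]; apply/nbhs_ballP; exists (e / 2); first by rewrite /= divr_gt0.
  move=> y [/= y1 y2]; apply: eP; apply: le_lt_trans (edist_le _ _) _.
  by rewrite [e]splitr ltrD.
move/nbhs_ballP => [e /= e0 eP]; exists e => // y xy; apply: eP; split.
  exact: le_lt_trans (norm_fst_le_edist _ _) xy.
exact: le_lt_trans (norm_snd_le_edist _ _) xy.
Qed.

Lemma continuous_polar s (f h : R -> R) : continuous f -> continuous h ->
  continuous (fun t => polar s (f t) (h t)).
Proof.
move=> cf ch t.
have c1 : {for t, continuous (fun t => s.1 + f t * cos (h t))}.
  apply: continuousD; first exact: cst_continuous.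
  apply: continuousM; first exact: cf.
  exact: (continuous_comp (ch t) (@continuous_cos R (h t))).
have c2 : {for t, continuous (fun t => s.2 + f t * sin (h t))}.
  apply: continuousD; first exact: cst_continuous.
  apply: continuousM; first exact: cf.
  exact: (continuous_comp (ch t) (@continuous_sin R (h t))).
exact: cvg_pair c1 c2.
Qed.

(** The parameter [l] is not confined to [[0, 1]]: for fixed [l], the map in [y] is the homothety of
    centre [s] and ratio [l]. *)
Definition segpt s y l : pt := (s.1 + l * (y.1 - s.1), s.2 + l * (y.2 - s.2)).

Lemma continuous_segpt s y : continuous (segpt s y).
Proof.
have c (u v l : R) : {for l, continuous (fun l : R => u + l * v)}.
  apply: continuousD; first exact: cst_continuous.
  by apply: continuousM; [exact: cvg_id|exact: cst_continuous].
by move=> l; exact: cvg_pair (c _ _ l) (c _ _ l).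
Qed.

Lemma polar_segpt s r r' t : r != 0 -> polar s r' t = segpt s (polar s r t) (r' / r).
Proof. by move=> r0; rewrite /polar /segpt/=; congr pair; field. Qed.

(** Were [A] and [B] disjoint on the interval, [A] would be both open and closed in it, hence
    contain all of it by connectedness. *)
Lemma interval_closed_cover (A B : set R) u v : u <= v ->
  closed A -> closed B -> `[u, v] `<=` A `|` B -> A u -> B v ->
  exists2 z, u <= z <= v & A z /\ B z.
Proof.
move=> uv cA cB AB Au Bv; apply: contrapT => noz.
have AvB : `[u, v] `&` A = `[u, v] `&` ~` B.
  apply/seteqP; split=> z [uzv Az]; split=> //.
    by move=> Bz; apply: noz; exists z => //; move: uzv; rewrite /= in_itv.
  by case: (AB z uzv) => // /Az.
have : (`[u, v] `&` A) v.
  rewrite (@segment_connected R u v (`[u, v] `&` A)).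
  - by rewrite /= in_itv/= uv lexx.
  - by exists u; split => //; rewrite /= in_itv/= uv lexx.
  - by exists (~` B) => //; exact: closed_openC.
  - by exists A.
by move=> [_ Av]; apply: noz; exists v => //; rewrite uv lexx.
Qed.

Lemma polarD2pi s r t : polar s r (t + 2 * pi) = polar s r t.
Proof. by rewrite mulr_natl /polar cosD2pi sinD2pi. Qed.

Lemma polarD2pi_int s r t (k : int) : polar s r (t + k%:~R * (2 * pi)) = polar s r t.
Proof.
have H n u : polar s r (u + n%:R * (2 * pi)) = polar s r u.
  elim: n => [|n IH]; first by rewrite mul0r addr0.
  by rewrite -natr1 mulrDl mul1r addrA polarD2pi.
case: k => n; first exact: H.
by rewrite -(H n.+1 (t + _)) NegzE mulrNz mulNr addrNK.
Qed.

End Plane.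

(** * Star-shaped environments *)

Section Environment.
Variables (R : realType) (P : set (R * R)) (g : R -> R * R) (s : R * R).
Hypotheses (Pg : environment P g) (Ps : star_kernel P s) (sP : P° s).
Local Notation pt := (R * R)%type.
Implicit Types (x y z : pt) (r t u v : R).

(** * Periodicity, injectivity and compactness of the curve *)

Lemma curve_continuous : continuous g.
Proof.
case: Pg => -[gc _] _ t; apply/cvg_ballP => e e0.
have [d d0 gd] := gc t e e0.
apply/nbhs_ballP; exists d => //= u tu; split => /=.
  by rewrite /ball/= distrC; apply: le_lt_trans (norm_fst_le_edist _ _) (gd _ _); rewrite distrC.
by rewrite /ball/= distrC; apply: le_lt_trans (norm_snd_le_edist _ _) (gd _ _); rewrite distrC.
Qed.

Lemma curveD_int t (k : int) : g (t + k%:~R) = g t.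
Proof.
case: Pg => -[_ [g1 _]] _.
have H n u : g (u + n%:R) = g u.
  elim: n => [|n IH]; first by rewrite addr0.
  by rewrite -natr1 addrA g1.
case: k => n; first exact: H.
by rewrite -(H n.+1 (t + _)) NegzE mulrNz addrNK.
Qed.

(** Both parameters reduce to [[0, 1)] by integer shifts, so [t - u] is an integer of absolute value
    below 1. *)
Lemma curve_inj t u : `|t - u| < 1 -> g t = g u -> t = u.
Proof.
case: (Pg) => -[_ [_ gi]] _ tu gtu.
have fr (v : R) : 0 <= v + (- Num.floor v)%:~R < 1.
  have /andP[] := floor_itv v; rewrite intrD mulrNz => ? ?.
  by apply/andP; split; lra.
have E : t + (- Num.floor t)%:~R = u + (- Num.floor u)%:~R.
  by apply: gi => //; rewrite !curveD_int.
have {}E : t - u = (Num.floor t - Num.floor u)%:~R.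
  by move: E; rewrite intrB !mulrNz => E; lra.
have : (Num.floor t - Num.floor u)%R = 0.
  by move: tu; rewrite E -intr_norm ltrz1; move: (_ - _) => [[|n]|n].
by move=> k0; apply/eqP; rewrite -subr_eq0 E k0.
Qed.

Lemma range_curve_segment (a b : R) : compact (g @` `[a, b]).
Proof.
apply: continuous_compact; last exact: segment_compact.
exact/continuous_subspaceT/curve_continuous.
Qed.

Lemma range_curve t0 x : range g x -> exists2 t, t0 <= t < t0 + 1 & g t = x.
Proof.
move=> [t _ <-]; exists (t + (- Num.floor (t - t0))%:~R); last exact: curveD_int.
have /andP[] := floor_itv (t - t0); rewrite intrD mulrNz => ? ?.
by apply/andP; split; lra.
Qed.

Lemma closed_range_curve : closed (range g).
Proof.
rewrite (_ : range g = g @` `[0, 1]).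
  apply: compact_closed; last exact: range_curve_segment.
  exact: norm_hausdorff.
apply/seteqP; split=> x; last by move=> [t _ <-]; exists t.
move/(range_curve 0) => [t /andP[t0 t1] <-]; exists t => //=.
by rewrite in_itv/=; apply/andP; split; lra.
Qed.

Lemma curve_polar_bounded : exists M, forall t r th, g t = polar s r th -> r < M.
Proof.
pose f t := ((g t).1 - s.1) ^+ 2 + ((g t).2 - s.2) ^+ 2.
have cf : continuous f.
  move=> t.
  have c1 : {for t, continuous (fun t => (g t).1 - s.1)}.
    apply: continuousB; last exact: cst_continuous.
    exact: (continuous_comp (curve_continuous (x := t)) cvg_fst).
  have c2 : {for t, continuous (fun t => (g t).2 - s.2)}.
    apply: continuousB; last exact: cst_continuous.
    exact: (continuous_comp (curve_continuous (x := t)) cvg_snd).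
  exact: continuousD (continuousM c1 c1) (continuousM c2 c2).
have [|c _ fc] := @EVT_max R f 0 1 ler01; first exact: continuous_subspaceT.
(* [f] is the squared distance to [s], and [r ^ 2 <= f c] implies [r < f c + 1]. *)
exists (f c + 1) => t r th gt.
have [u /andP[u0 u1] gu] := range_curve 0 (ex_intro2 _ _ t I gt).
have := fc u; rewrite in_itv/= u0 ltW/= ?(lt_le_trans u1) ?add0r// => /(_ isT).
rewrite {1}/f gu /polar/=; have := cos2Dsin2 th => E.
have -> : (s.1 + r * cos th - s.1) ^+ 2 + (s.2 + r * sin th - s.2) ^+ 2 = r ^+ 2.
  by rewrite -[RHS]mulr1 -E; ring.
by move=> ?; nra.
Qed.

(** * The enclosed region and the components of the complement of the curve *)

Lemma enclosed_connected (A : set pt) x y : connected A -> A `<=` ~` range g ->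
  A x -> A y -> P x -> P y.
Proof.
case: Pg => _ -> cA Ag Ax Ay [/(Ag _ Ax)//|[ngx bx]].
right; split; first exact: Ag.
rewrite (_ : connected_component _ y = connected_component (~` range g) x)//.
apply: same_connected_component; apply: (connected_component_max Ay Ag cA).
exact: Ax.
Qed.

Lemma enclosed_component_bounded (A : set pt) x : connected A -> A `<=` ~` range g ->
  A x -> P x -> bounded_plane A.
Proof.
case: Pg => _ -> cA Ag Ax [/(Ag _ Ax)//|[ngx [M bM]]].
by exists M => y Ay; apply: bM; exact: (connected_component_max Ax Ag cA).
Qed.

(** A small ball around [x] misses the curve, and its radii are connected. This local constancy
    gives both the closedness of [P] and the inclusion of its boundary in the curve. *)
Lemma near_enclosed x : ~ range g x -> \forall y \near x, P y <-> P x.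
Proof.
move=> ngx; have : nbhs x (~` range g).
  by apply: open_nbhs_nbhs; split => //; exact/closed_openC/closed_range_curve.
move/nbhs_ballP => [e /= e0 eg]; apply/nbhs_ballP; exists e => //= y xy.
have seg_ball l : 0 <= l <= 1 -> ball x e (segpt x y l).
  case: xy; rewrite /ball/= => xy1 xy2 /andP[l0 l1].
  split; rewrite /ball/= opprD addNKr normrN normrM (ger0_norm l0) distrC.
    by apply: le_lt_trans xy1; rewrite ler_piMl.
  by apply: le_lt_trans xy2; rewrite ler_piMl.
pose A := segpt x y @` `[0, 1].
have cA : connected A.
  apply: connected_continuous_connected; first exact: segment_connected.
  exact/continuous_subspaceT/continuous_segpt.
have Ag : A `<=` ~` range g.
  by move=> _ [l /= + <-]; rewrite in_itv/= => /seg_ball/eg.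
have Ax : A x.
  by exists 0; rewrite /= ?in_itv/= ?lexx ?ler01// /segpt !mul0r !addr0 -surjective_pairing.
have Ay : A y.
  by exists 1; rewrite /= ?in_itv/= ?lexx ?ler01// /segpt !mul1r !subrKC -surjective_pairing.
by split; [exact: (enclosed_connected cA Ag Ay Ax)|exact: (enclosed_connected cA Ag Ax Ay)].
Qed.

Lemma enclosed_range x : range g x -> P x.
Proof. by case: Pg => _ -> ?; left. Qed.

Lemma closed_enclosed : closed P.
Proof.
rewrite -openC openE => x nPx.
have /near_enclosed : ~ range g x by move/enclosed_range.
by apply: filterS => y [Pyx _] /Pyx.
Qed.

(* Only the inclusion of [bd] in [range g] is clear at this point; equality is
   [range_not_interior]. *)
Definition bd := P `\` P°.

Lemma closed_bd : closed bd.
Proof. by apply: closedI; [exact: closed_enclosed|apply: open_closedC; exact: open_interior]. Qed.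

Lemma bd_range x : bd x -> range g x.
Proof.
move=> [Px nPx]; apply: contrapT => /near_enclosed nx; apply: nPx.
by apply: filterS nx => y [_]; exact.
Qed.

(** * Boundary points on rays from [s] *)

Lemma polar_kernel r r' th : 0 <= r' <= r -> P (polar s r th) -> P (polar s r' th).
Proof.
move=> /andP[r0 rr] /(Ps.2) seg.
have [rE|rn] := eqVneq r 0.
  by rewrite (_ : r' = 0); [rewrite /polar !mul0r !addr0 -surjective_pairing; exact: Ps.1|lra].
rewrite (polar_segpt _ _ _ rn); apply: seg; exists (r' / r) => //.
have r_gt0 : 0 < r by rewrite lt_neqAle eq_sym rn/= (le_trans r0).
by rewrite divr_ge0 ?(ltW r_gt0)//= ler_pdivrMr// mul1r.
Qed.

(** The homothety [h] carries the inner point to the outer one, so [P] pulls back to a neighbourhood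
    of the inner point. The inverse contraction towards [s] keeps this neighbourhood in [P]. For
    [r' = 0] the point is [s] itself. *)
Lemma polar_interior r r' th : 0 <= r' <= r -> P° (polar s r th) -> P° (polar s r' th).
Proof.
move=> /andP[r0 rr] Pi; have [->|rn0] := eqVneq r' 0.
  by rewrite /polar !mul0r !addr0 -surjective_pairing.
have r'0 : 0 < r' by rewrite lt_neqAle eq_sym rn0.
have r_gt0 : 0 < r by exact: lt_le_trans rr.
pose h z : pt := segpt s z (r / r').
have ch : {for polar s r' th, continuous h}.
  have c1 : {for polar s r' th, continuous (fun z : pt => s.1 + r / r' * (z.1 - s.1))}.
    apply: continuousD; first exact: cst_continuous.
    apply: continuousM; first exact: cst_continuous.
    apply: continuousB; last exact: cst_continuous.
    exact: cvg_fst.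
  have c2 : {for polar s r' th, continuous (fun z : pt => s.2 + r / r' * (z.2 - s.2))}.
    apply: continuousD; first exact: cst_continuous.
    apply: continuousM; first exact: cst_continuous.
    apply: continuousB; last exact: cst_continuous.
    exact: cvg_snd.
  exact: cvg_pair c1 c2.
have hE : h (polar s r' th) = polar s r th by rewrite /h -polar_segpt.
have : nbhs (polar s r' th) (h @^-1` P) by apply: ch; rewrite hE.
rewrite /interior; apply: filterS => z Phz.
have -> : z = segpt s (h z) (r' / r).
  rewrite /h /segpt [LHS]surjective_pairing/=; congr pair; field; lra.
apply: (Ps.2 _ Phz); exists (r' / r) => //.
by rewrite divr_ge0 ?(ltW r_gt0) ?(ltW r'0)//= ler_pdivrMr// mul1r.
Qed.

(** The outer point forces the middle one into [P], the inner point keeps it out of the interior. *)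
Lemma bd_polar_convex r1 r2 r th : 0 <= r1 -> r1 <= r <= r2 ->
  bd (polar s r1 th) -> bd (polar s r2 th) -> bd (polar s r th).
Proof.
move=> r10 /andP[r1r rr2] [_ n1] [P2 _]; split.
  by apply: polar_kernel P2; rewrite rr2 (le_trans r10).
by move=> Pr; apply: n1; apply: polar_interior Pr; rewrite r10.
Qed.

(** The witness is the supremum of the radii of interior points on the ray. It is finite because the
    part of a ray beyond the curve is connected and unbounded, so it cannot lie in a bounded
    component. *)
Lemma bd_ray th : exists2 r, 0 <= r & bd (polar s r th).
Proof.
have p0 : polar s 0 th = s by rewrite /polar !mul0r !addr0 -surjective_pairing.
have [M gM] := curve_polar_bounded.
pose S := [set r | 0 <= r /\ P° (polar s r th)].
have S0 : S 0 by rewrite /S/= p0.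
have SM : ubound S M.
  move=> r [r0 /interior_subset Pr]; rewrite leNgt; apply/negP => Mr.
  pose A := (fun u => polar s u th) @` `[r, +oo[.
  have cA : connected A.
    apply: connected_continuous_connected.
      exact/connected_intervalP/interval_is_interval.
    apply: continuous_subspaceT; apply: continuous_polar => u; first exact: cvg_id.
    exact: cst_continuous.
  have Ag : A `<=` ~` range g.
    move=> _ [u /= + <-] [t _ /gM]; rewrite in_itv/= andbT => ru; lra.
  have Ar : A (polar s r th) by exists r => //=; rewrite in_itv/= lexx.
  have [B bB] := enclosed_component_bounded cA Ag Ar Pr.
  (* A radius so large that, as [|cos| + |sin| >= 1], the two coordinate bounds cannot both hold. *)
  pose u := Num.max r (B + B + `|s.1| + `|s.2| + 1).
  have [|] := bB (polar s u th).
    by exists u => //=; rewrite in_itv/= andbT le_max lexx.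
  rewrite /polar/= => H1 H2.
  have uB : B + B + `|s.1| + `|s.2| + 1 <= u by rewrite le_max lexx orbT.
  have u0 : 0 <= u by rewrite le_max r0.
  have B1 : `|u * cos th| <= B + `|s.1|.
    have -> : u * cos th = s.1 + u * cos th - s.1 by ring.
    by apply: le_trans (ler_normB _ _) _; rewrite lerD2r.
  have B2 : `|u * sin th| <= B + `|s.2|.
    have -> : u * sin th = s.2 + u * sin th - s.2 by ring.
    by apply: le_trans (ler_normB _ _) _; rewrite lerD2r.
  have : u <= `|u * cos th| + `|u * sin th|.
    rewrite !normrM (ger0_norm u0) -mulrDr ler_peMr//.
    have := cos2Dsin2 th; have := cos_max th; have := sin_max th.
    rewrite -(real_normK (num_real (cos th))) -(real_normK (num_real (sin th))).
    by move: (normr_ge0 (cos th)) (normr_ge0 (sin th)); move: `|_| `|_| => ? ?; nra.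
  lra.
have hS : has_sup S by split; [exists 0|exists M].
have r0 : 0 <= sup S by apply: ub_le_sup => //; exists M.
have cr : {for sup S, continuous (fun u => polar s u th)}.
  apply: continuous_polar => u; first exact: cvg_id.
  exact: cst_continuous.
exists (sup S) => //; split.
  apply: contrapT => nP.
  have : nbhs (polar s (sup S) th) (~` P).
    by apply: open_nbhs_nbhs; split => //; exact/closed_openC/closed_enclosed.
  move/cr/nbhs_ballP => [e /= e0 eP].
  have [r Sr sr] := sup_adherent e0 hS.
  apply: (eP r); last by case: Sr => _ /interior_subset.
  have : r <= sup S by apply: ub_le_sup => //; exists M.
  by move=> rs; rewrite /ball/= ger0_norm; lra.
move=> iP.
have : nbhs (polar s (sup S) th) P°.
  by apply: open_nbhs_nbhs; split => //; exact: open_interior.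
move/cr/nbhs_ballP => [e /= e0 eP].
have : S (sup S + e / 2).
  split; first by lra.
  by apply: eP; rewrite /ball/= opprD addNKr normrN gtr0_norm; lra.
move/(ub_le_sup (ex_intro _ M SM)); lra.
Qed.

(* Otherwise the segment of the ray between [g u] and [g v] would be covered by
   the disjoint compact sets [g [a, m]] and [g [m, b]]. *)
Lemma range_fiber a b th u m v r1 r2 :
  (forall x, bd x -> exists2 t, a <= t <= b & g t = x) -> b - a < 1 ->
  a <= u -> u <= m -> m <= v -> v <= b -> 0 <= r1 -> 0 <= r2 ->
  g u = polar s r1 th -> g v = polar s r2 th -> bd (g u) -> bd (g v) ->
  exists r, [/\ 0 <= r, g m = polar s r th & bd (g m)].
Proof.
move=> bdg ba au um mv vb r10 r20 gu gv bu bv.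
pose h r := polar s r th.
have ch : continuous h.
  apply: continuous_polar => z; first exact: cvg_id.
  exact: cst_continuous.
have clo c d : closed (h @^-1` (g @` `[c, d])).
  apply: closed_comp => [z _|]; first exact: ch.
  by apply: compact_closed; [exact: norm_hausdorff|exact: range_curve_segment].
have bdr r : r1 <= r <= r2 \/ r2 <= r <= r1 -> 0 <= r /\ bd (h r).
  rewrite gu in bu; rewrite gv in bv.
  case=> rr; (split; first by case/andP: rr => [? ?]; lra).
    exact: bd_polar_convex bu bv.
  exact: bd_polar_convex bv bu.
have cover r : bd (h r) -> (g @` `[a, m]) (h r) \/ (g @` `[m, b]) (h r).
  move=> /bdg [t /andP[at_ tb] gt]; have [tm|mt] := leP t m; [left|right];
    by exists t => //=; rewrite in_itv/= ?at_ ?tb ?tm ?(ltW mt).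
have Au : (h @^-1` (g @` `[a, m])) r1 by exists u => //=; rewrite in_itv/= au um.
have Bv : (h @^-1` (g @` `[m, b])) r2 by exists v => //=; rewrite in_itv/= mv vb.
have [r [rr [Ar Br]]] : exists r, (r1 <= r <= r2 \/ r2 <= r <= r1) /\
    (h @^-1` (g @` `[a, m])) r /\ (h @^-1` (g @` `[m, b])) r.
  have [r12|/ltW r21] := leP r1 r2.
    have [|z rz ABz] := interval_closed_cover r12 (clo a m) (clo m b) _ Au Bv.
      move=> z; rewrite /= in_itv/= => rz; apply: cover.
      by have [] := bdr z (or_introl rz).
    by exists z; split => //; left.
  have [|z rz ABz] := interval_closed_cover r21 (clo m b) (clo a m) _ Bv Au.
    move=> z; rewrite /= in_itv/= => rz; apply/or_comm; apply: cover.
    by have [] := bdr z (or_intror rz).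
  by exists z; split; [right|case: ABz].
have [r0 br] := bdr r rr.
case: Ar => x /=; rewrite in_itv/= => /andP[ax xm] gx.
case: Br => y /=; rewrite in_itv/= => /andP[my yb] gy.
(* Here [x <= m <= y] and [y - x < 1], so injectivity of the curve makes the three parameters
   equal. *)
have xy : x = y.
  apply: curve_inj; last by rewrite gx gy.
  by rewrite distrC ger0_norm; lra.
have xE : x = m by apply/eqP; rewrite eq_le xm xy my.
by exists r; split => //; rewrite -xE gx.
Qed.

(* The boundary on the ray of direction [th] is met by [g] before the boundary on
   the opposite ray. *)
Definition antipodal a b th := exists t t', [/\ a <= t, t <= t', t' <= b,
  (bd (g t) /\ exists2 r, 0 <= r & g t = polar s r th) &
  (bd (g t') /\ exists2 r, 0 <= r & g t' = polar s r (th + pi))].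

Lemma bd_neq_center x : bd x -> x <> s.
Proof. by move=> [_ nx] xs; apply: nx; rewrite xs. Qed.

Lemma bd_opposite x r r' th : bd x -> 0 <= r -> 0 <= r' ->
  x = polar s r th -> x = polar s r' (th + pi) -> False.
Proof.
move=> /bd_neq_center xs r0 r'0 xE; rewrite xE /polar cosDpi sinDpi => -[E1 E2].
have r00 : r = 0.
  have := cos2Dsin2 th; set c := cos th in E1 *; set d := sin th in E2 * => E.
  have H1 : (r + r') * c = 0 by lra.
  have H2 : (r + r') * d = 0 by lra.
  have : (r + r') * (c ^+ 2 + d ^+ 2) = 0.
    by rewrite mulrDr !expr2 !mulrA H1 H2 !mul0r addr0.
  by rewrite E; lra.
by apply: xs; rewrite xE r00 /polar !mul0r !addr0 -surjective_pairing.
Qed.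

(** Among the four parameters, one of [u1] and [t2] lies between two parameters of the ray opposite
    to its own. By [range_fiber] its point would be on both rays. *)
Lemma antipodal_excl a b th :
  (forall x, bd x -> exists2 t, a <= t <= b & g t = x) -> b - a < 1 ->
  antipodal a b th -> antipodal a b (th + pi) -> False.
Proof.
move=> bdg ba [t1 [u1 [at1 tu1 u1b [bt1 [r1 r10 gt1]] [bu1 [q1 q10 gu1]]]]].
move=> [u2 [t2 [au2 ut2 t2b [bu2 [q2 q20 gu2]] [bt2 [r2 r20 gt2]]]]].
rewrite -addrA (_ : pi + pi = 2 * pi) ?polarD2pi in gt2; last by ring.
have [ut|tu] := leP u1 t2.
  have [r [r0 gr _]] := range_fiber bdg ba at1 tu1 ut t2b r10 r20 gt1 gt2 bt1 bt2.
  exact: bd_opposite bu1 r0 q10 gr gu1.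
have [r [r0 gr _]] := range_fiber bdg ba au2 ut2 (ltW tu) u1b q20 q10 gu2 gu1 bu2 bu1.
exact: bd_opposite bt2 r20 r0 gt2 gr.
Qed.

Lemma antipodal_cover a b th :
  (forall x, bd x -> exists2 t, a <= t <= b & g t = x) ->
  antipodal a b th \/ antipodal a b (th + pi).
Proof.
move=> bdg; have [r r0 br] := bd_ray th; have [q q0 bq] := bd_ray (th + pi).
have [t /andP[at_ tb] gt] := bdg _ br; have [u /andP[au ub] gu] := bdg _ bq.
have [tu|/ltW ut] := leP t u; [left; exists t, u|right; exists u, t].
  by split; rewrite ?gt ?gu//; split => //; [exists r|exists q].
split; rewrite ?gt ?gu//; split => //; [exists q|exists r] => //.
by rewrite -addrA (_ : pi + pi = 2 * pi) ?polarD2pi//; ring.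
Qed.

Lemma antipodalD2pi a b th : antipodal a b (th + pi + pi) = antipodal a b th.
Proof.
have E u r : polar s r (u + pi + pi) = polar s r u.
  by rewrite -addrA (_ : pi + pi = 2 * pi) ?polarD2pi//; ring.
apply/propext; split=> -[t [u [? ? ? [? [r r0 gt]] [? [q q0 gu]]]]];
  exists t, u; split => //; split => //; [exists r|exists q|exists r|exists q];
  by rewrite ?gt ?gu ?E// (addrAC th) E.
Qed.

(** A point is on the ray exactly when its cross product [X] with the direction vanishes and its
    inner product [Y] is nonnegative. Both are continuous jointly in the point and the angle. *)
Lemma closed_ray : closed [set p : pt * R | exists2 r, 0 <= r & p.1 = polar s r p.2].
Proof.
pose X (p : pt * R) := (p.1.1 - s.1) * sin p.2 - (p.1.2 - s.2) * cos p.2.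
pose Y (p : pt * R) := (p.1.1 - s.1) * cos p.2 + (p.1.2 - s.2) * sin p.2.
have c1 (p : pt * R) : {for p, continuous (fun p : pt * R => p.1.1 - s.1)}.
  apply: continuousB; last exact: cst_continuous.
  exact: (continuous_comp (f := fst) (g := fst) cvg_fst cvg_fst).
have c2 (p : pt * R) : {for p, continuous (fun p : pt * R => p.1.2 - s.2)}.
  apply: continuousB; last exact: cst_continuous.
  exact: (continuous_comp (f := fst) (g := snd) cvg_fst cvg_snd).
have ccos (p : pt * R) : {for p, continuous (fun p : pt * R => cos p.2)}.
  exact: (continuous_comp (f := snd) cvg_snd (@continuous_cos R _)).
have csin (p : pt * R) : {for p, continuous (fun p : pt * R => sin p.2)}.
  exact: (continuous_comp (f := snd) cvg_snd (@continuous_sin R _)).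
have cX : continuous X.
  by move=> p; exact: continuousB (continuousM (c1 p) (csin p)) (continuousM (c2 p) (ccos p)).
have cY : continuous Y.
  by move=> p; exact: continuousD (continuousM (c1 p) (ccos p)) (continuousM (c2 p) (csin p)).
rewrite (_ : mkset _ = X @^-1` [set 0] `&` Y @^-1` [set y | 0 <= y]).
  apply: closedI; apply: closed_comp => [p _|].
  - exact: cX.
  - exact: closed_eq.
  - exact: cY.
  - exact: closed_ge.
apply/seteqP; split=> -[[x y] th] /=; rewrite /X /Y /=.
  move=> [r r0]; rewrite /polar => -[-> ->]; have E := cos2Dsin2 th.
  split; first by ring.
  rewrite (_ : _ + _ = r * (cos th ^+ 2 + sin th ^+ 2)); last by ring.
  by rewrite E mulr1.
move=> [X0 Y0]; exists (Y (x, y, th)) => //.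
rewrite /polar /Y/=; have E := cos2Dsin2 th.
set c := cos th in X0 E *; set d := sin th in X0 E *.
congr pair.
  have -> : s.1 + ((x - s.1) * c + (y - s.2) * d) * c =
    s.1 + (x - s.1) * (c ^+ 2 + d ^+ 2) - d * ((x - s.1) * d - (y - s.2) * c) by ring.
  by rewrite E X0; ring.
have -> : s.2 + ((x - s.1) * c + (y - s.2) * d) * d =
  s.2 + (y - s.2) * (c ^+ 2 + d ^+ 2) + c * ((x - s.1) * d - (y - s.2) * c) by ring.
by rewrite E X0; ring.
Qed.

(** The set is the projection of a compact set of triples: an angle and two curve parameters. *)
Lemma closed_antipodal a b lo hi : closed [set th | lo <= th <= hi /\ antipodal a b th].
Proof.
pose T := (R * (R * R))%type.
pose D := [set p : pt * R | exists2 r, 0 <= r & p.1 = polar s r p.2].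
pose f1 (p : T) := g p.2.1; pose f2 (p : T) := g p.2.2.
pose d1 (p : T) := (f1 p, p.1); pose d2 (p : T) := (f2 p, p.1 + pi).
pose e (p : T) := p.2.1 - p.2.2.
have c1 (p : T) : {for p, continuous (fun p : T => p.2.1)}.
  exact: (continuous_comp (f := snd) (g := fst) cvg_snd cvg_fst).
have c2 (p : T) : {for p, continuous (fun p : T => p.2.2)}.
  exact: (continuous_comp (f := snd) (g := snd) cvg_snd cvg_snd).
have cf1 : continuous f1 by move=> p; exact: (continuous_comp (c1 p) (@curve_continuous _)).
have cf2 : continuous f2 by move=> p; exact: (continuous_comp (c2 p) (@curve_continuous _)).
have cd1 : continuous d1 by move=> p; exact: cvg_pair (cf1 p) cvg_fst.
have cpi (p : T) : {for p, continuous (fun p : T => p.1 + pi)}.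
  by apply: continuousD; [exact: cvg_fst|exact: cst_continuous].
have cd2 : continuous d2 by move=> p; exact: cvg_pair (cf2 p) (cpi p).
have ce : continuous e by move=> p; exact: continuousB (c1 p) (c2 p).
pose Q : set T := (`[lo, hi] `*` (`[a, b] `*` `[a, b])) `&`
  (e @^-1` [set x | x <= 0] `&` ((f1 @^-1` bd `&` d1 @^-1` D) `&` (f2 @^-1` bd `&` d2 @^-1` D))).
have cQ : compact Q.
  apply: compact_closedI.
    by apply: compact_setX; [|apply: compact_setX]; exact: segment_compact.
  apply: closedI; first by apply: closed_comp => [p _|]; [exact: ce|exact: closed_le].
  apply: closedI; apply: closedI; apply: closed_comp => [p _|].
  - exact: cf1.
  - exact: closed_bd.
  - exact: cd1.
  - exact: closed_ray.
  - exact: cf2.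
  - exact: closed_bd.
  - exact: cd2.
  - exact: closed_ray.
rewrite (_ : mkset _ = fst @` Q).
  apply: compact_closed; first exact: norm_hausdorff.
  apply: continuous_compact cQ; apply: continuous_subspaceT => p; exact: cvg_fst.
apply/seteqP; split => th.
  move=> [lohi [t [u [au tu ub [bt rt] [bu ru]]]]]; exists (th, (t, u)) => //.
  split; last by split=> //=; rewrite /e/= subr_le0.
  split=> /=; first by rewrite in_itv.
  by split; rewrite /= in_itv/=; apply/andP; split; lra.
move=> [[th' [t u]] [[lohi [tab uab]] [tu [[bt rt] [bu ru]]]] <-].
move: lohi tab uab tu; rewrite /= !in_itv/= /e/= subr_le0.
move=> lohi /andP[at_ tb] /andP[au ub] tu; split => //.
by exists t, u; split.
Qed.

(** An interior curve point leaves the whole of [bd] on an arc of parameter length below 1. The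
    angles of [[0, pi]] with either order of opposite rays then form two closed sets that cover the
    interval and meet, against [antipodal_excl]. *)
Lemma range_not_interior x : range g x -> ~ P° x.
Proof.
move=> [t0 _ <-] iP.
have : nbhs (g t0) P° by apply: open_nbhs_nbhs; split => //; exact: open_interior.
move/(@curve_continuous t0)/nbhs_ballP => [e /= e0 eP].
pose d := Num.min (e / 2) (1 / 4).
have d0 : 0 < d by rewrite lt_min; apply/andP; split; lra.
have de : d < e by rewrite gt_min; apply/orP; left; lra.
have d4 : d <= 1 / 4 by rewrite ge_min lexx orbT.
pose a := t0 + d; pose b := t0 + 1 - d.
have ba : b - a < 1 by rewrite /a /b; lra.
have near_t0 u : `|u - t0| <= d -> P° (g u).
  by move=> u0; apply: eP; rewrite /ball/= distrC (le_lt_trans u0).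
have bdg x' : bd x' -> exists2 t, a <= t <= b & g t = x'.
  move=> bx; have [t /andP[t0t t1] gt] := range_curve t0 (bd_range bx).
  have nx u : g u = x' -> d < `|u - t0|.
    by move=> gu; rewrite ltNge; apply/negP => /near_t0; rewrite gu; case: bx.
  exists t => //; rewrite /a /b; apply/andP; split.
    by have := nx t gt; rewrite ger0_norm; lra.
  (* By periodicity [t - 1] parametrises the same point, and it approaches [t0] from the left. *)
  have := nx (t - 1); rewrite -gt -(curveD_int t (-1)) mulrN1z => /(_ erefl).
  by rewrite ltr0_norm; lra.
pose A lo hi := [set th | lo <= th <= hi /\ antipodal a b th].
have p0 := @pi_gt0 R.
have [th _ [/= [_ A1] [_ A2]]] : exists2 th : R, 0 <= th <= pi &
    A 0 pi th /\ A pi (pi + pi) (th + pi).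
  have cA := @closed_antipodal a b.
  have cB : closed ((fun th => th + pi) @^-1` A pi (pi + pi)).
    apply: closed_comp => [th _|]; last exact: cA.
    by apply: (@continuousD _ _ _ id (cst pi)); [exact: cvg_id|exact: cst_continuous].
  have cov : `[0, pi] `<=` A 0 pi `|` (fun th => th + pi) @^-1` A pi (pi + pi).
    move=> th; rewrite /= in_itv/= => thp.
    have [] := antipodal_cover th bdg; [left|right]; split => //.
    by move: thp => /andP[? ?]; apply/andP; split; lra.
  (* The order found at angle 0 recurs at [pi + pi], which is what the second set requires at its
     end [pi]. In the other case the two sets trade ends. *)
  have [A0|A0] := antipodal_cover 0 bdg.
    apply: (interval_closed_cover (ltW p0) (cA 0 pi) cB cov).
      by split => //; rewrite lexx ltW.
    split; first by apply/andP; split; lra.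
    by rewrite -[X in X + pi]add0r antipodalD2pi.
  rewrite add0r in A0.
  have [|||th thp [Bth Ath]] := interval_closed_cover (ltW p0) cB (cA 0 pi).
  - by rewrite setUC.
  - by split; rewrite add0r//; apply/andP; split; lra.
  - by split => //; rewrite lexx ltW.
  - by exists th.
exact: antipodal_excl bdg ba A1 A2.
Qed.

Lemma arc_angles_has_sup (x : R) : has_sup (arc_angles P s x).
Proof.
split; first by exists 0; split; [rewrite lexx mulr_ge0// pi_ge0|left].
by exists (2 * pi) => th [/andP[]].
Qed.

Lemma alpha_bounds (x : R) : 0 <= alpha P s x <= 2 * pi.
Proof.
have [[y Ay] ub] := arc_angles_has_sup x; apply/andP; split.
  apply: ub_le_sup => //; split; last by left.
  by rewrite lexx mulr_ge0// pi_ge0.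
by apply: ge_sup; [exists y|move=> th [/andP[]]].
Qed.

Lemma spiral_hits a beta psi phi0 (x : R) t0 : 0 < a -> 0 < cos beta / sin beta ->
  a * expR (phi0 * (cos beta / sin beta)) = x -> range g (polar s x t0) ->
  exists2 phi, phi <= phi0 + alpha P s x & range g (spiral s a beta psi phi).
Proof.
move=> a0; set c := cos beta / sin beta => c0 xE gx; apply: contrapT => nohit.
have x0 : 0 < x by rewrite -xE mulr_gt0// expR_gt0.
pose sp := spiral s a beta psi.
have csp : continuous sp.
  have c1 (u : R) : {for u, continuous (fun u : R => u * c)}.
    by apply: continuousM; [exact: cvg_id|exact: cst_continuous].
  have c2 (u : R) : {for u, continuous (fun u : R => a * expR (u * c))}.
    apply: continuousM; first exact: cst_continuous.
    exact: (continuous_comp (c1 u) (@continuous_expR R _)).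
  have c3 (u : R) : {for u, continuous (fun u : R => u + psi)}.
    by apply: continuousD; [exact: cvg_id|exact: cst_continuous].
  exact: continuous_polar c2 c3.
set phi1 := phi0 + alpha P s x in nohit.
(* As the curve is closed, the spiral misses it slightly beyond [phi1] as well. This excess [e] is
   what contradicts the supremum [alpha]. *)
have [e e0 he] : exists2 e, 0 < e & forall phi, phi <= phi1 + e -> ~ range g (sp phi).
  have : nbhs (sp phi1) (~` range g).
    apply: open_nbhs_nbhs; split; first exact/closed_openC/closed_range_curve.
    by move=> gp; apply: nohit; exists phi1.
  move/csp/nbhs_ballP => [e /= e0 eg]; exists (e / 2) => [|phi phie gp].
    by rewrite divr_gt0.
  have [le|lt] := leP phi phi1; first by apply: nohit; exists phi.
  by apply: (eg phi) gp; rewrite /ball/= ltr0_norm; lra.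
have spP phi : phi <= phi1 + e -> P° (sp phi).
  move=> phie.
  have [d d0 dP] : int_pt P s by rewrite int_ptE.
  (* At this angle the spiral radius is at most [d / 2], so the spiral is still in a disc inside
     [P]. *)
  pose phis := Num.min phi1 (ln (d / (2 * a)) / c).
  have Ps' : P (sp phis).
    apply: dP; rewrite edist_polar ?mulr_ge0 ?expR_ge0 ?ltW//.
    have le : expR (phis * c) <= d / (2 * a).
      rewrite -[leRHS]lnK ?posrE ?divr_gt0 ?mulr_gt0// ler_expR.
      by rewrite -ler_pdivlMr// ge_min lexx orbT.
    have : a * expR (phis * c) <= a * (d / (2 * a)) by rewrite ler_pM2l.
    have -> : a * (d / (2 * a)) = d / 2 by field; lra.
    lra.
  pose A := sp @` `]-oo, phi1 + e].
  have cA : connected A.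
    apply: connected_continuous_connected.
      exact/connected_intervalP/interval_is_interval.
    exact: continuous_subspaceT.
  have Ag : A `<=` ~` range g by move=> _ [u /= + <-]; rewrite in_itv/= => /he.
  have As : A (sp phis).
    by exists phis => //=; rewrite in_itv/= ge_min; apply/orP; left; lra.
  have Ap : A (sp phi) by exists phi => //=; rewrite in_itv.
  have Pp := enclosed_connected cA Ag As Ap Ps'.
  by apply: filterS (near_enclosed (he _ phie)) => y [_]; apply.
have arc t : 0 <= t <= alpha P s x + e -> P° (polar s x (phi0 + psi + t)).
  move=> /andP[tt te].
  rewrite addrAC; apply: (polar_interior (r := a * expR ((phi0 + t) * c))).
    by rewrite ltW//= -xE ler_pM2l// ler_expR ler_pM2r//; lra.
  by apply: spP; rewrite /phi1; lra.
have p0 := @pi_gt0 R.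
(* Angles in [arc_angles] are capped at [2 * pi], so the excess yields a contradiction directly only
   below a full turn. *)
pose th := Num.min (alpha P s x + e) (2 * pi).
have /andP[al0 al1] := alpha_bounds x.
have the : th <= alpha P s x + e by rewrite ge_min lexx.
have thp : th <= 2 * pi by rewrite ge_min lexx orbT.
have : arc_angles P s x th.
  split; first by rewrite thp andbT le_min; apply/andP; split; lra.
  right; exists (phi0 + psi) => t /andP[tt tth]; rewrite int_ptE; apply: arc.
  by rewrite tt (le_trans tth).
move/(ub_le_sup (arc_angles_has_sup x).2); rewrite -/(alpha P s x) => thal.
have full : 2 * pi <= alpha P s x + e.
  by move: thal; rewrite /th ge_min => /orP[]; lra.
(* Subtracting [k] full turns brings [t0] into the interior arc, which now covers the whole
   circle. *)
pose k := Num.floor ((t0 - (phi0 + psi)) / (2 * pi)).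
apply: (range_not_interior gx).
have := floor_itv ((t0 - (phi0 + psi)) / (2 * pi)); rewrite -/k intrD.
rewrite ler_pdivlMr ?ltr_pdivrMr ?mulr_gt0// => /andP[k1 k2].
have -> : t0 = phi0 + psi + (t0 - (phi0 + psi) - k%:~R * (2 * pi)) + k%:~R * (2 * pi) by ring.
by rewrite polarD2pi_int; apply: arc; apply/andP; split; lra.
Qed.

(** A disc about [s] of some radius [d] consists of interior points, hence contains no curve point,
    and every admissible [x] is at least [d]. *)
Lemma certificate_length_gt0 : 0 < certificate_length P g s.
Proof.
have [d d0 dP] : int_pt P° s.
  by rewrite int_ptE (_ : P°° = P°)//; apply/interior_id; exact: open_interior.
have [r r0 br] := bd_ray 0.
have rn0 : r != 0.
  apply/eqP => rE; apply: (bd_neq_center br).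
  by rewrite rE /polar !mul0r !addr0 -surjective_pairing.
apply: (lt_le_trans d0); apply: lb_le_inf.
  exists (r * (1 + alpha P s r)); exists r => //; split; last by exists 0; exact: bd_range.
  by rewrite lt_neqAle eq_sym rn0.
move=> _ [x [x0 [t gx]] <-].
have /andP[al0 _] := alpha_bounds x.
have dx : d <= x.
  rewrite leNgt; apply/negP => xd; apply: (range_not_interior gx).
  by apply: dP; rewrite edist_polar// ltW.
by apply: (le_trans dx); rewrite ler_peMr ?(ltW x0)//; lra.
Qed.

End Environment.

(** * The chord estimate and the competitive ratio *)

(** Convexity of the exponential. For [b = 2 * pi] and [M = ln (2 * pi + 1)] the chord is
    [1 + x]. *)
Lemma expR_le_chord (R : realType) (b M x : R) : 0 < b -> 0 <= x <= b ->
  expR (x * (M / b)) <= 1 + x * ((expR M - 1) / b).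
Proof.
move=> b0 /andP[x0 xb]; set y := x * (M / b); set u := x / b.
have u01 : 0 <= u <= 1 by rewrite divr_ge0 ?(ltW b0)//= ler_pdivrMr// mul1r.
have yE : y = u * M by rewrite /y /u; ring.
(* Tangent lines at [y], averaged over the end points [0] and [M]. *)
have E z : expR y * (1 + (z - y)) <= expR z.
  have := expR_ge1Dx (z - y).
  by rewrite -(ler_pM2l (expR_gt0 y)) -expRD (_ : y + (z - y) = z)//; ring.
have E0 := E 0; rewrite expR0 in E0.
have -> : 1 + x * ((expR M - 1) / b) = (1 - u) * 1 + u * expR M by rewrite /u; ring.
have -> : expR y = (1 - u) * (expR y * (1 + (0 - y))) + u * (expR y * (1 + (M - y))).
  by rewrite yE; ring.
by case/andP: u01 => u0 u1; rewrite lerD// ler_wpM2l// subr_ge0.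
Qed.

(** The angle [psi] accounts for rotations of [P]. Since [spiral_length] increases with [phi], a
    bound at any meeting point also bounds the length up to the first one. *)
Theorem theorem1 (R : realType) (beta a : R)
  (hbeta : 0 < beta < pi / 2)
  (hcot : cos beta / sin beta = ln (2 * pi + 1) / (2 * pi))
  (ha : 0 < a)
  (P : set (R * R)%type) (g : R -> (R * R)%type) (s : (R * R)%type)
  (psi : R) :
  environment P g -> star_kernel P s -> int_pt P s ->
  exists phi : R, range g (spiral s a beta psi phi) /\
    spiral_length a beta phi < (3318674%:Z)%:~R / (1000000%:Z)%:~R * certificate_length P g s.
Proof.
move=> Pg Ps; rewrite int_ptE => sP.
have C1 := cos_beta_gt hbeta hcot; move: C1; set C := (X in X * cos beta) => C1.
have L0 := certificate_length_gt0 Pg Ps sP; set L := certificate_length P g s in L0 *.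
have p0 := @pi_gt0 R.
have cb : 0 < cos beta.
  by apply: cos_gt0_pihalf; case/andP: hbeta => ? ?; apply/andP; split; lra.
have sb : 0 < sin beta by exact: sin_gt0_pihalf.
have c0 : 0 < cos beta / sin beta by exact: divr_gt0.
pose S := [set x * (1 + alpha P s x) | x in meets_boundary g s].
have hS : has_inf S.
  split.
    (* The infimum of the empty set is 0 by convention, so positivity of [L] excludes it. *)
    apply: contrapT => /set0P/negP; rewrite negbK => /eqP S0.
    by move: L0; rewrite /L /certificate_length -/S S0 inf0 ltxx.
  exists 0 => _ [x [x0 _] <-]; have /andP[? _] := alpha_bounds P s x.
  by rewrite mulr_ge0 ?(ltW x0)//; lra.
(* The slack in [C * cos beta > 1] makes an almost minimal radius sufficient: its cost is below
   [L * C * cos beta]. *)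
have LC : 0 < L * (C * cos beta - 1) by rewrite mulr_gt0// subr_gt0.
have [_ [x [x0 [t gx]] <-] xL] := inf_adherent LC hS.
have /andP[al0 al1] := alpha_bounds P s x.
(* The angle at which the spiral has radius [x]. *)
pose phi0 := ln (x / a) / (cos beta / sin beta).
have xE : a * expR (phi0 * (cos beta / sin beta)) = x.
  by rewrite divfK ?gt_eqF// lnK ?posrE ?divr_gt0// mulrC divfK ?gt_eqF.
have [phi phile gphi] := spiral_hits Pg Ps sP psi ha c0 xE gx.
exists phi; split => //.
have le1 : a * expR (phi * (cos beta / sin beta)) <= x * (1 + alpha P s x).
  apply: (@le_trans _ _ (x * expR (alpha P s x * (cos beta / sin beta)))).
    by rewrite -{1}xE -mulrA -expRD -mulrDl ler_pM2l// ler_expR ler_pM2r.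
  rewrite ler_pM2l// hcot.
  have := @expR_le_chord R (2 * pi) (ln (2 * pi + 1)) (alpha P s x).
  rewrite lnK ?posrE; last by lra.
  rewrite addrK divff ?mulr1; last by rewrite mulf_neq0 ?gt_eqF.
  by apply; rewrite ?mulr_gt0 ?ln_gt0 ?al0//; lra.
rewrite /spiral_length mulrAC ltr_pdivrMr//.
apply: le_lt_trans le1 _; apply: lt_le_trans xL _.
rewrite -/(certificate_length P g s) -/L -[X in _ <= X * _ * _]/C.
by clearbody C; lra.
Qed.
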